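(* Let $\mathbb{F}_q$ be a finite field and $\mathcal{A}$ the arrangement of all lines in $\mathrm{PG}(2,q)$. Choose a line $H\in\mathcal{A}$ and $q-1$ (distinct) points $v_1,\ldots,v_{q-1}$ on $H$. For each $v_i$, choose $q-1$ further (distinct) lines $H^i_1,\ldots,H^i_{q-1}$, different from $H$, through $v_i$. Then \[ \mathcal{B}:=\mathcal{A}\setminus\{H^i_j\mid 1\le i,j\le q-1\} \] is a combinatorially simplicial arrangement with $3q$ lines.
   Context: Lines of $\mathrm{PG}(2,q)$ are identified with the linear hyperplanes of $\mathbb{F}_q^3$, and points with one-dimensional subspaces. An arrangement of hyperplanes is a finite set of hyperplanes in $V=K^r$; it is central if all hyperplanes are linear subspaces, and a central arrangement is essential if the intersection of all its hyperplanes is $0$. The intersection lattice $L(\mathcal{A})$ is the set of all intersections of elements of $\mathcal{A}$ (including $V$ as the empty intersection), ordered by reverse inclusion. The characteristic polynomial is $\chi_{\mathcal{A}}(t)=\sum_{X\in L(\mathcal{A})}\mu(X)t^{\dim X}$, where $\mu(X)=\mu(V,X)$ is the Möbius function of $L(\mathcal{A})$. For $X\in L(\mathcal{A})$ the restriction is $\mathcal{A}^X=\{X\cap H\mid H\in\mathcal{A},\ X\not\subseteq H,\ X\cap H\neq\emptyset\}$, an arrangement in $X$. A finite set $\mathcal{A}$ of hyperplanes in $K^r$ is (combinatorially) simplicial if it is a central, essential arrangement satisfying $r\chi_{\mathcal{A}}(-1)+2\sum_{H\in\mathcal{A}}\chi_{\mathcal{A}^H}(-1)=0$. *)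

(* Defs.v *)
From mathcomp Require Import all_boot all_order all_algebra.
From mathcomp Require Import finmap.

Set Implicit Arguments.
Unset Strict Implicit.
Unset Printing Implicit Defensive.

Import GRing.Theory.
Local Open Scope fset_scope.
Local Open Scope ring_scope.

(* The recursion of [mobius_rec] is on a fuel argument; [size L] steps are
   enough to descend from any element of L (see [mobiusE]). *)
Section Mobius.
Variables (T : choiceType) (le : rel T) (L : {fset T}).

Fixpoint mobius_rec (n : nat) (x y : T) : int :=
  if n is n'.+1 then
    if x == y then 1
    else - \sum_(z <- L | [&& le x z, le z y & z != y]) mobius_rec n' x z
  else 0.

Definition mobius (x y : T) : int := mobius_rec #|` L| x y.

Hypotheses (le_refl : reflexive le) (le_anti : antisymmetric le)
  (le_trans : transitive le).

Lemma mobius_recE n m x y : y \in L ->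
  (#|` [fset z in L | le z y]| <= n)%N ->
  (#|` [fset z in L | le z y]| <= m)%N ->
  mobius_rec n x y = mobius_rec m x y.
Proof.
elim: n m y => [|n IHn] m y yL.
  rewrite leqn0 cardfs_eq0 => /eqP/fsetP/(_ y).
  by rewrite !inE /= yL le_refl.
case: m => [_|m].
  rewrite leqn0 cardfs_eq0 => /eqP/fsetP/(_ y).
  by rewrite !inE /= yL le_refl.
move=> hn hm /=; case: eqP => // _; congr (- _).
rewrite big_seq_cond [in RHS]big_seq_cond; apply: eq_bigr => z /and4P[zL _ lezy zny].
have lt : (#|` [fset t in L | le t z]| < #|` [fset t in L | le t y]|)%N.
  apply: fproper_ltn_card; rewrite fproperE; apply/andP; split.
    apply/fsubsetP => t; rewrite !inE /= => /andP[-> /le_trans]; exact.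
  apply/negP => /fsubsetP /(_ y); rewrite !inE /= yL le_refl => /(_ isT) leyz.
  by case/eqP: zny; apply: le_anti; rewrite lezy.
by apply: IHn => //; rewrite -ltnS; exact: leq_trans lt _.
Qed.

Lemma mobius_fuel n x y : y \in L -> (#|` L| <= n)%N ->
  mobius_rec n x y = mobius x y.
Proof.
move=> yL hn; have sub : (#|` [fset z in L | le z y]| <= #|` L|)%N.
  by apply/fsubset_leq_card/fsubsetP => t; rewrite !inE => /andP[].
by apply: mobius_recE => //; exact: leq_trans hn.
Qed.

Lemma mobiusE x y : y \in L ->
  mobius x y =
    if x == y then 1
    else - \sum_(z <- L | [&& le x z, le z y & z != y]) mobius x z.
Proof.
by move=> yL; rewrite -(mobius_fuel (n := #|` L|.+1)) //=; case: eqP.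
Qed.

End Mobius.

(* Hyperplanes are linear subspaces throughout, so every arrangement is central
   and the condition X :&: H <> empty in the definition of a restriction always
   holds.  The ambient space is a subspace W of vT, so that the restriction to
   X is again an arrangement, with ambient space X. *)
Section Arrangement.
Variables (K : fieldType) (vT : vectType K).
Implicit Types (W X Y H : {vspace vT}) (A : {fset {vspace vT}}).

Definition central_arrangement W A : Prop :=
  forall H, H \in A -> (H <= W)%VS /\ \dim W = (\dim H).+1.

Definition essential W A : Prop := (W :&: \bigcap_(H <- A) H)%VS = 0%VS.

Definition intersection_lattice W A : {fset {vspace vT}} :=
  [fset (W :&: \bigcap_(H <- B) H)%VS | B : {fset {vspace vT}} in fpowerset A].

Definition reverse_inclusion : rel {vspace vT} := fun X Y => (Y <= X)%VS.

Definition char_poly_arr W A : {poly int} :=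
  \sum_(X <- intersection_lattice W A)
    mobius reverse_inclusion (intersection_lattice W A) W X *: 'X^(\dim X).

Definition restriction A X : {fset {vspace vT}} :=
  [fset (X :&: H)%VS | H in A & ~~ (X <= H)%VS].

Definition simplicial W A : Prop :=
  [/\ central_arrangement W A, essential W A &
      (\dim W)%:Z * (char_poly_arr W A).[-1]
      + 2 * \sum_(H <- A) (char_poly_arr H (restriction A H)).[-1] = 0].

Lemma reverse_inclusion_refl : reflexive reverse_inclusion.
Proof. by move=> X; exact: subvv. Qed.

Lemma reverse_inclusion_anti : antisymmetric reverse_inclusion.
Proof. by move=> X Y sXY; apply/eqP; rewrite eqEsubv andbC. Qed.

Lemma reverse_inclusion_trans : transitive reverse_inclusion.
Proof. by move=> Y X Z sYX sZY; exact: subv_trans sZY sYX. Qed.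

End Arrangement.

(* {vspace 'rV[F]_3} has no finType structure, so the finite set of all lines
   of PG(2, q) is listed as the set of 2-dimensional spans of two vectors. *)
Section ProjectivePlane.
Variable F : finFieldType.

Definition pg2_lines : {fset {vspace 'rV[F]_3}} :=
  [fset H in [fset (<[p.1]> + <[p.2]>)%VS | p : 'rV[F]_3 * 'rV[F]_3]
     | \dim H == 2%N].

Lemma mem_pg2_lines H : (H \in pg2_lines) = (\dim H == 2%N).
Proof.
rewrite !inE /=; case: eqP => [dH|_]; last by rewrite andbF.
rewrite andbT; apply/imfsetP.
have dHv : \dim (fullv : {vspace 'rV[F]_3}) = 3%N by rewrite dimvf /dim /= mul1n.
have := span_basis (vbasisP H); move: (vbasis H); rewrite dH => s <-.
case/tupleP: s => u s; case/tupleP: s => w s; rewrite tuple0 /=.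
by exists (u, w) => //=; rewrite span_cons span_seq1.
Qed.

Definition is_point (P : {vspace 'rV[F]_3}) : Prop := \dim P = 1%N.

End ProjectivePlane.

(* Main.v *)
Require Import Defs.
From mathcomp Require Import all_boot all_order all_algebra all_field.
From mathcomp Require Import finmap zify ring.

Set Implicit Arguments.
Unset Strict Implicit.
Unset Printing Implicit Defensive.

(** The arrangement B consists of 3q lines, and every point of the plane lies on
    at least two of them.  These two facts alone give simpliciality
    ([simplicial_thick]).

    If every point P has multiplicity m_P >= 2, that is, lies on m_P lines of the
    arrangement, then the rank two elements of the intersection lattice are all
    q^2 + q + 1 points of the plane, and the restriction to a line consists of
    all its q + 1 points.  Since the Moebius values over the lattice sum to 0,
    the value of the characteristic polynomial at -1 is -2 times the sum of the
    Moebius values at the elements of odd dimension ([char_poly_arrN1]).  In rank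
    two this is twice the number of points, here 2(q + 1); in rank three it is
    -2 (1 + \sum_P (m_P - 1)).  Counting incident pairs (P, X) of a point and one
    of the n lines gives \sum_P m_P = n (q + 1), hence the defining equation reads
    -6 (n (q + 1) - q^2 - q) + 4 n (q + 1) = 0, that is, n = 3q.

    To see that B qualifies: the deleted lines are pairwise distinct, because such
    a line meets H in v_i and hence determines i ([removed_inj]), so that
    q^2 + q + 1 - (q - 1)^2 = 3q lines remain.  A point P lies on q + 1 lines of the
    plane and on at most q - 1 deleted ones ([card_removed_through]): if P is on H,
    all of them pass through the same v_i, and if P is off H, at most one passes
    through each v_i. *)

Import GRing.Theory.
Local Open Scope fset_scope.
Local Open Scope ring_scope.

(** * Intersection lattices and characteristic polynomials *)

Lemma sumN1_fset (T : choiceType) (C : {fset T}) :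
  \sum_(x <- C) (-1 : int) = - #|` C|%:Z.
Proof. by rewrite sumrN card_fset_sum1 -natz natr_sum. Qed.

Lemma in_fset_cond (T : choiceType) (S : {fset T}) (p : pred T) x :
  (x \in [fset y in S | p y]) = (x \in S) && p x.
Proof. by rewrite !inE. Qed.

Section Lattice.
Variables (K : fieldType) (vT : vectType K).
Implicit Types (W X Y H P : {vspace vT}) (A C : {fset {vspace vT}}).

Local Notation L := intersection_lattice.
Local Notation mu W A := (mobius (@reverse_inclusion K vT) (L W A) W).

Lemma subv_bigcap_fsetP X C :
  reflect (forall H, H \in C -> (X <= H)%VS) (X <= \bigcap_(H <- C) H)%VS.
Proof.
rewrite big_seq_fsetE /=; apply: (iffP subv_bigcapP) => [sXC H HC|sXC H _].
  exact: (sXC [` HC]).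
exact: sXC.
Qed.

Lemma latticeP W A X :
  reflect (exists2 C, C `<=` A & X = (W :&: \bigcap_(H <- C) H)%VS) (X \in L W A).
Proof.
apply: (iffP (imfsetP _ _ _ _)) => -[C /=].
  by rewrite fpowersetE => sCA ->; exists C.
by move=> sCA ->; exists C; rewrite ?fpowersetE.
Qed.

Lemma lattice_subv W A X : X \in L W A -> (X <= W)%VS.
Proof. by case/latticeP => C _ ->; exact: capvSl. Qed.

Lemma lattice_top W A : W \in L W A.
Proof.
by apply/latticeP; exists fset0; rewrite ?fsub0set // big_seq_fset0 capvf.
Qed.

Lemma lattice_essential W A : essential W A -> 0%VS \in L W A.
Proof. by move=> <-; apply/latticeP; exists A. Qed.

Lemma lattice_proper W A X :
  X \in L W A -> X != W -> exists2 H, H \in A & (X <= H)%VS.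
Proof.
case/latticeP => C /fsubsetP sCA -> ; have [->|/fset0Pn[H HC] _] := eqVneq C fset0.
  by rewrite big_seq_fset0 capvf eqxx.
exists H; first exact: sCA.
by apply: subv_trans (capvSr _ _) _; apply: (subv_bigcap_fsetP _ _ (subvv _)).
Qed.

Lemma lattice_capv W A H H' :
  central_arrangement W A -> H \in A -> H' \in A -> (H :&: H')%VS \in L W A.
Proof.
move=> cA HA H'A; apply/latticeP; exists [fset H; H'].
  by apply/fsubsetP => X; rewrite !inE => /orP[] /eqP ->.
apply: subv_anti; rewrite !subv_cap; apply/andP; split.
  apply/andP; split; first exact: subv_trans (capvSl _ _) (cA _ HA).1.
  apply/subv_bigcap_fsetP => X; rewrite !inE => /orP[] /eqP ->.
    exact: capvSl.
  exact: capvSr.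
have sC X : X \in [fset H; H'] -> (W :&: \bigcap_(Y <- [fset H; H']) Y <= X)%VS.
  by apply: (subv_bigcap_fsetP _ _ (capvSr _ _)).
by rewrite !sC // !inE eqxx ?orbT.
Qed.

Lemma lattice_hyperplane W A H :
  central_arrangement W A -> H \in A -> H \in L W A.
Proof. by move=> cA HA; rewrite -[H]capvv lattice_capv. Qed.

Lemma lattice_dimv_eq W A X :
  X \in L W A -> (\dim X == \dim W) = (X == W).
Proof.
move=> /lattice_subv sXW; apply/eqP/eqP => [dX|-> //].
by apply/eqP; rewrite eqEdim sXW dX leqnn.
Qed.

(** A lattice element other than the ambient space lies in some hyperplane of the
    arrangement, and equals it if it has the same dimension. *)
Lemma lattice_codim1 W A X :
  central_arrangement W A -> (X \in L W A) && (\dim W == (\dim X).+1) = (X \in A).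
Proof.
move=> cA; apply/andP/idP => [[XL /eqP dX]|XA]; last first.
  by rewrite lattice_hyperplane // (cA _ XA).2.
have XW : X != W by apply: contra_eqN dX => /eqP ->; apply/eqP; lia.
have [H HA sXH] := lattice_proper XL XW.
suff -> : X = H by [].
by apply/eqP; rewrite eqEdim sXH; have := (cA _ HA).2; lia.
Qed.

Lemma mobius_top W A : mu W A W = 1.
Proof.
by rewrite (mobiusE (@reverse_inclusion_refl _ _) (@reverse_inclusion_anti _ _)
  (@reverse_inclusion_trans _ _)) ?lattice_top // eqxx.
Qed.

Lemma mobius_lattice W A X : X \in L W A -> X != W ->
  mu W A X = - \sum_(Y <- L W A | (X <= Y)%VS && (Y != X)) mu W A Y.
Proof.
move=> XL XW; rewrite (mobiusE (@reverse_inclusion_refl _ _)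
  (@reverse_inclusion_anti _ _) (@reverse_inclusion_trans _ _)) //.
rewrite eq_sym (negPf XW); congr (- _).
rewrite big_seq_cond [RHS]big_seq_cond; apply: eq_bigl => Y.
have [YL|//] := boolP (Y \in L W A).
by rewrite /reverse_inclusion (lattice_subv YL).
Qed.

Lemma mobius_hyperplane W A H :
  central_arrangement W A -> H \in A -> mu W A H = -1.
Proof.
move=> cA HA; have HL := lattice_hyperplane cA HA; have [sHW dH] := cA _ HA.
have HW : H != W by apply: contra_eqN dH => /eqP ->; apply/eqP; lia.
rewrite mobius_lattice // big_fset_condE.
rewrite (_ : [fset _ | _ in _ & _] = [fset W]) ?big_seq_fset1 ?mobius_top //.
apply/fsetP => Y; rewrite !inE /=; apply/andP/eqP => [[YL /andP[sHY YH]]|->].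
  apply/eqP; rewrite -(lattice_dimv_eq YL); apply/eqP.
  have := dimvS (lattice_subv YL); have := dimvS sHY.
  have /negP : ~~ (\dim Y <= \dim H)%N.
    by apply: contraNN YH => dYH; rewrite eq_sym eqEdim sHY.
  lia.
by rewrite lattice_top sHW eq_sym.
Qed.

Lemma sum_mobius W A :
  essential W A -> W != 0%VS -> \sum_(X <- L W A) mu W A X = 0.
Proof.
move=> eA W0; have L0 := lattice_essential eA.
rewrite (big_fsetD1 _ L0) /= mobius_lattice 1?eq_sym //.
apply/eqP; rewrite addrC subr_eq0; apply/eqP.
rewrite [RHS]big_fset_condE; apply: eq_fbigl => X.
by rewrite !inE /= sub0v andbC.
Qed.

(** Subtracting the vanishing sum of the Moebius values from the alternating sum
    kills the even dimensions and doubles the odd ones.  This removes the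
    Moebius value at 0, the only one that is laborious to compute in low
    rank. *)
Lemma char_poly_arrN1 W A : essential W A -> W != 0%VS ->
  (char_poly_arr W A).[-1] = - 2 * \sum_(X <- L W A | odd (\dim X)) mu W A X.
Proof.
move=> eA W0; rewrite -[LHS]subr0 -[X in _ - X](sum_mobius eA W0) horner_sum -sumrB.
rewrite (bigID (fun X => odd (\dim X))) /= [X in _ + X]big1 ?addr0 => [|X Xe].
  rewrite mulr_sumr; apply: eq_bigr => X Xo.
  by rewrite hornerZ hornerXn -signr_odd Xo; ring.
by rewrite hornerZ hornerXn -signr_odd (negPf Xe); ring.
Qed.

Lemma char_poly_arr_rank2 W A :
  central_arrangement W A -> essential W A -> \dim W = 2%N ->
  (char_poly_arr W A).[-1] = 2 * #|` A|%:Z.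
Proof.
move=> cA eA dW; rewrite char_poly_arrN1 //; last by rewrite -dimv_eq0 dW.
rewrite big_fset_condE (_ : [fset _ | _ in _ & _] = A); last first.
  apply/fsetP => X; rewrite -(lattice_codim1 _ cA) !inE /= dW.
  have [XL|//] := boolP (X \in L W A).
  by have := dimvS (lattice_subv XL); rewrite dW; case: (\dim X) => [|[|[|?]]].
rewrite (eq_big_seq (fun=> -1)) => [|X XA]; last exact: mobius_hyperplane.
by rewrite sumN1_fset; ring.
Qed.

(** The only lattice elements strictly containing P are W, of Moebius value 1,
    and the hyperplanes through P, of Moebius value -1. *)
Lemma mobius_rank3 W A P : central_arrangement W A -> \dim W = 3%N ->
  P \in L W A -> \dim P = 1%N ->
  mu W A P = #|` [fset H in A | (P <= H)%VS]|%:Z - 1.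
Proof.
move=> cA dW PL dP; have PW : P != W by apply: contra_eqN dP => /eqP ->; rewrite dW.
rewrite mobius_lattice // big_fset_condE.
rewrite (_ : [fset _ | _ in _ & _] = W |` [fset H in A | (P <= H)%VS]); last first.
  apply/fsetP => Y; rewrite in_fset1U !inE /=.
  rewrite -(lattice_codim1 _ cA) dW.
  have [->|YW] := eqVneq Y W.
    by rewrite lattice_top eq_sym PW (lattice_subv PL).
  have [YL|//] := boolP (Y \in L W A); rewrite /= [RHS]andbC.
  have [sPY/=|//] := boolP (P <= Y)%VS; rewrite -(lattice_dimv_eq YL) in YW.
  have -> : (Y == P) = (\dim Y == 1%N).
    apply/eqP/eqP => [-> //|dY]; apply/eqP.
    by rewrite eq_sym eqEdim sPY dY dP.
  have := dimvS sPY; have := dimvS (lattice_subv YL); move: YW; lia.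
rewrite big_fsetU1 /=; last first.
  by rewrite !inE /= -(lattice_codim1 _ cA); lia.
rewrite mobius_top (eq_big_seq (fun=> -1)) => [|X].
  by rewrite sumN1_fset; ring.
by rewrite !inE /= => /andP[XA _]; exact: mobius_hyperplane.
Qed.

Lemma char_poly_arr_rank3 W A :
  central_arrangement W A -> essential W A -> \dim W = 3%N ->
  (char_poly_arr W A).[-1] =
  - 2 * (1 + \sum_(P <- L W A | \dim P == 1%N)
               (#|` [fset H in A | (P <= H)%VS]|%:Z - 1)).
Proof.
move=> cA eA dW; rewrite char_poly_arrN1 //; last by rewrite -dimv_eq0 dW.
congr (_ * _); rewrite big_fset_condE [in RHS]big_fset_condE.
rewrite (_ : [fset _ | _ in _ & odd _] = W |` [fset P in L W A | \dim P == 1%N]).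
  rewrite big_fsetU1 /=; last by rewrite !inE /= dW andbF.
  rewrite mobius_top; congr (_ + _); apply: eq_big_seq => P.
  by rewrite !inE /= => /andP[PL /eqP dP]; exact: mobius_rank3.
apply/fsetP => X; rewrite in_fset1U !inE /=.
have [->|XW] := eqVneq X W; first by rewrite lattice_top dW.
have [XL/=|//] := boolP (X \in L W A); rewrite -(lattice_dimv_eq XL) dW in XW.
have := dimvS (lattice_subv XL); rewrite dW.
by move: XW; case: (\dim X) => [|[|[|[|?]]]].
Qed.

End Lattice.

(** * Counting subspaces over a finite field *)

Section Counting.
Variables (F : finFieldType) (n : nat).
Implicit Types (Q U X : {vspace 'rV[F]_n}) (S : {fset {vspace 'rV[F]_n}}).

Lemma card_vspaceD Q U : (Q <= U)%VS ->
  (\sum_(u : 'rV[F]_n | (u \in U) && (u \notin Q)) 1 =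
     #|F| ^ \dim U - #|F| ^ \dim Q)%N.
Proof.
move=> /subvP sQU; rewrite sum1_card -!card_vspace.
have -> : #|Q| = #|[predI U & Q]|.
  by apply: eq_card => u; rewrite !inE; apply/esym/andb_idl; exact: sQU.
rewrite -(cardID (mem Q) (mem U)) addKn.
by apply: eq_card => u; rewrite !inE andbC.
Qed.

(** Each vector u of U outside Q lies in exactly one X of S, namely Q + <[u]>, so
    the sets X \ Q partition U \ Q.  With Q = 0 this counts the points of U,
    and with Q a point it counts the lines through it. *)
Lemma card_cover_vspace Q U S : (Q <= U)%VS ->
  (forall X, (X \in S) = [&& Q <= X, X <= U & \dim X == (\dim Q).+1]%VS) ->
  (#|` S| * (#|F| ^ (\dim Q).+1 - #|F| ^ \dim Q) =
     #|F| ^ \dim U - #|F| ^ \dim Q)%N.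
Proof.
move=> sQU memS; rewrite -(card_vspaceD sQU) card_fset_sum1 big_distrl /=.
have SE X : X \in S ->
    (1 * (#|F| ^ (\dim Q).+1 - #|F| ^ \dim Q) =
     \sum_(u | (u \in U) && (u \notin Q) && (u \in X)) 1)%N.
  rewrite memS => /and3P[sQX /subvP sXU /eqP <-]; rewrite mul1n -card_vspaceD //.
  apply: eq_bigl => u; have [uX|] := boolP (u \in X); last by rewrite andbF.
  by rewrite sXU ?andbT.
rewrite (eq_big_seq _ SE) (exchange_big_dep (fun u => (u \in U) && (u \notin Q))) /=;
  last by move=> X u _ /andP[].
apply: eq_bigr => u /andP[uU uQ]; rewrite big_fset_condE -card_fset_sum1.
have sQuU : (Q + <[u]> <= U)%VS by rewrite subv_add sQU -memvE.
have dQu : \dim (Q + <[u]>) = (\dim Q).+1.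
  have u0 : u != 0 by apply: contraNneq uQ => ->; exact: mem0v.
  have := dimv_sum_cap Q <[u]>; rewrite dim_vline u0.
  suff -> : (Q :&: <[u]>)%VS = 0%VS by rewrite dimv0; lia.
  apply/eqP; rewrite -dimv_eq0 -leqn0 -ltnS.
  have := (dimv_leqif_eq (capvSr Q <[u]>)); rewrite dim_vline u0 => dQu.
  rewrite (ltn_leqif dQu); apply: contra uQ => /eqP Qu.
  by rewrite memvE -Qu capvSl.
rewrite (_ : [fset _ | _ in _ & _] = [fset (Q + <[u]>)%VS]) ?cardfs1 //.
apply/fsetP => X; rewrite !inE /= memS; apply/andP/eqP => [|->].
  move=> [/and3P[sQX sXU /eqP dX] /andP[_ uX]]; apply/eqP; rewrite eq_sym eqEdim.
  by rewrite subv_add sQX -memvE uX dX dQu leqnn.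
by rewrite sQuU addvSl dQu eqxx uU uQ memvE addvSr.
Qed.

End Counting.

(** * Incidence counts in the projective plane *)

Section Plane.
Variable F : finFieldType.
Implicit Types (P H X U : {vspace 'rV[F]_3}) (A S : {fset {vspace 'rV[F]_3}}).

Local Notation q := #|F|.

Definition pg2_points : {fset {vspace 'rV[F]_3}} :=
  [fset <[u]>%VS | u in {: 'rV[F]_3} & u != 0].

Lemma mem_pg2_points P : (P \in pg2_points) = (\dim P == 1%N).
Proof.
apply/imfsetP/eqP => [[u /=]|dP]; first by rewrite !inE /= => u0 ->; rewrite dim_vline u0.
exists (vpick P); first by rewrite !inE /= vpick0 -dimv_eq0 dP.
apply/eqP; rewrite eq_sym eqEdim -memvE memv_pick dim_vline dP vpick0.
by rewrite -dimv_eq0 dP.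
Qed.

Lemma card_field_gt1 : (1 < q)%N.
Proof. exact: card_finNzRing_gt1. Qed.

Lemma dim_pg2 : \dim (fullv : {vspace 'rV[F]_3}) = 3%N.
Proof. by rewrite dimvf /dim /= mul1n. Qed.

Lemma card_points_in U :
  (#|` [fset P in pg2_points | (P <= U)%VS]| * (q - 1) = q ^ \dim U - 1)%N.
Proof.
have := @card_cover_vspace F 3 0%VS U
  [fset P in pg2_points | (P <= U)%VS] (sub0v _).
rewrite dimv0 expn0 expn1; apply => X.
by rewrite in_fset_cond mem_pg2_points sub0v andbC.
Qed.

Lemma card_points_line H : \dim H = 2%N ->
  #|` [fset P in pg2_points | (P <= H)%VS]| = q.+1.
Proof.
move=> dH; have := card_points_in H; rewrite dH; have := card_field_gt1; nia.
Qed.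

Lemma card_points : #|` pg2_points| = (q ^ 2 + q + 1)%N.
Proof.
have := card_points_in fullv; rewrite dim_pg2; have := card_field_gt1.
rewrite (_ : [fset _ | _ in _ & _] = pg2_points); last first.
  by apply/fsetP => P; rewrite in_fset_cond subvf andbT.
rewrite !expnS expn0; nia.
Qed.

Lemma card_lines_through P : \dim P = 1%N ->
  #|` [fset H in pg2_lines F | (P <= H)%VS]| = q.+1.
Proof.
move=> dP; have := @card_cover_vspace F 3 P fullv
  [fset H in pg2_lines F | (P <= H)%VS] (subvf P).
rewrite dP dim_pg2 !expnS expn0 => cE; have {cE} := cE _; have := card_field_gt1.
move=> q1; suff memS : forall X, (X \in [fset H in pg2_lines F | (P <= H)%VS]) =
    [&& P <= X, X <= fullv & \dim X == 2%N]%VS by move/(_ memS); nia.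
by move=> X; rewrite in_fset_cond mem_pg2_lines subvf andbC.
Qed.

(** Double counting of the incidences between points and lines of A. *)
Lemma sum_point_multiplicity A : A `<=` pg2_lines F ->
  (\sum_(P <- pg2_points) #|` [fset H in A | (P <= H)%VS]| = #|` A| * q.+1)%N.
Proof.
move=> /fsubsetP sA.
under eq_bigr => P _ do rewrite card_fset_sum1 -big_fset_condE.
rewrite (exchange_big_dep xpredT) //= card_fset_sum1 big_distrl /=.
apply: eq_big_seq => H HA; have := sA _ HA; rewrite mem_pg2_lines mul1n => /eqP dH.
by rewrite big_fset_condE -card_fset_sum1 card_points_line.
Qed.

(** There are as many lines as points since the incidences number (q + 1) times
    either. *)
Lemma card_pg2_lines : #|` pg2_lines F| = (q ^ 2 + q + 1)%N.
Proof.
have := sum_point_multiplicity (fsubset_refl (pg2_lines F)).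
rewrite (eq_big_seq (fun=> q.+1)) => [|P]; last first.
  by rewrite mem_pg2_points => /eqP; exact: card_lines_through.
under eq_bigr => P _ do rewrite -[q.+1]mul1n.
rewrite -big_distrl -card_fset_sum1 card_points /=.
by move/eqP; rewrite eqn_mul2r => /eqP.
Qed.

Lemma dim_capv_lines H H' :
  \dim H = 2%N -> \dim H' = 2%N -> H != H' -> \dim (H :&: H') = 1%N.
Proof.
move=> dH dH' nHH'; have := dimv_sum_cap H H'; rewrite dH dH'.
have := dimvS (subvf (H + H')); rewrite dim_pg2.
have : (\dim (H :&: H') < 2)%N; last by lia.
rewrite -[X in (_ < X)%N]dH (ltn_leqif (dimv_leqif_eq (capvSl H H'))).
by apply: contra nHH' => /eqP HH'; rewrite eqEdim dH dH' andbT -HH' capvSr.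
Qed.

Lemma point_eq P P' : \dim P = 1%N -> \dim P' = 1%N -> (P <= P')%VS -> P = P'.
Proof. by move=> dP dP' sPP'; apply/eqP; rewrite eqEdim sPP' dP dP'. Qed.

(** A nonzero U would equal each of the at least two points of S.  This is what
    makes both an arrangement and its restrictions essential. *)
Lemma sub_points_eq0 S U : S `<=` pg2_points -> (1 < #|` S|)%N ->
  (forall P, P \in S -> (U <= P)%VS) -> U = 0%VS.
Proof.
move=> /fsubsetP sS S1 sU; apply/eqP; rewrite -dimv_eq0.
apply: contraLR S1 => dU; rewrite -leqNgt -[X in (_ <= X)%N](cardfs1 U).
apply/fsubset_leq_card/fsubsetP => P PS; rewrite inE eq_sym eqEdim sU //.
by move: (sS P PS); rewrite mem_pg2_points => /eqP ->; rewrite lt0n.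
Qed.

(** * Line sets with at least two lines through every point *)

Section Thick.
Variable A : {fset {vspace 'rV[F]_3}}.
Hypothesis sA : A `<=` pg2_lines F.
Hypothesis thickA :
  forall P, \dim P = 1%N -> (1 < #|` [fset H in A | (P <= H)%VS]|)%N.

Lemma dim_mem_lines H : H \in A -> \dim H = 2%N.
Proof. by move/(fsubsetP sA); rewrite mem_pg2_lines => /eqP. Qed.

Lemma central_lines : central_arrangement fullv A.
Proof. by move=> H HA; rewrite subvf dim_pg2 (dim_mem_lines HA). Qed.

Lemma thick_other_line P H : \dim P = 1%N ->
  exists2 H', H' \in A & (P <= H')%VS && (H' != H).
Proof.
move=> dP; have := thickA dP; rewrite (cardfsD1 H).
case: (fset_0Vmem ([fset H' in A | (P <= H')%VS] `\ H)) => [->|[H']].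
  by rewrite cardfs0 addn0 ltnNge leq_b1.
by rewrite !inE /= => /and3P[nH'H H'A PH'] _; exists H'; rewrite // PH'.
Qed.

Lemma point_capv P H H' : \dim P = 1%N -> H \in A -> H' \in A -> H != H' ->
  (P <= H)%VS -> (P <= H')%VS -> (H :&: H')%VS = P.
Proof.
move=> dP HA H'A nHH' sPH sPH'; apply/esym/point_eq => //.
  by rewrite dim_capv_lines ?dim_mem_lines.
by rewrite subv_cap sPH.
Qed.

(** Every point of H is cut out by a second line of A through it. *)
Lemma restriction_thick H : H \in A ->
  restriction A H = [fset P in pg2_points | (P <= H)%VS].
Proof.
move=> HA; apply/fsetP => P; rewrite in_fset_cond mem_pg2_points.
apply/imfsetP/andP => [[H' /= /andP[H'A nHH'] ->]|[/eqP dP sPH]].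
  rewrite capvSl dim_capv_lines ?dim_mem_lines //.
  by apply: contraNneq nHH' => ->; exact: subvv.
have [H' H'A /andP[sPH' nH'H]] := thick_other_line H dP.
exists H'; last by rewrite (@point_capv P) // eq_sym.
rewrite !inE /= H'A; apply: contra nH'H => sHH'.
by rewrite eq_sym eqEdim sHH' !dim_mem_lines.
Qed.

Lemma essential_thick : essential fullv A.
Proof.
apply: (sub_points_eq0 (fsubset_refl pg2_points)).
  by rewrite card_points; have := card_field_gt1; lia.
move=> P; rewrite mem_pg2_points capfv => /eqP dP.
(* Excluding 0 excludes nothing: this only picks some line through P. *)
have [H HA /andP[sPH _]] := thick_other_line 0 dP.
have [H' H'A /andP[sPH' nH'H]] := thick_other_line H dP.
rewrite -(@point_capv P H' H) // subv_cap.
by rewrite !(subv_bigcap_fsetP _ _ (subvv _)).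
Qed.

Lemma point_in_lattice P : \dim P = 1%N -> P \in intersection_lattice fullv A.
Proof.
(* Excluding 0 excludes nothing: this only picks some line through P. *)
move=> dP; have [H HA /andP[sPH _]] := thick_other_line 0 dP.
have [H' H'A /andP[sPH' nH'H]] := thick_other_line H dP.
by rewrite -(@point_capv P H' H) // lattice_capv //; exact: central_lines.
Qed.

Lemma char_poly_restriction_thick H : H \in A ->
  (char_poly_arr H (restriction A H)).[-1] = 2 * q.+1%:Z.
Proof.
move=> HA; have dH := dim_mem_lines HA.
rewrite restriction_thick // char_poly_arr_rank2 ?card_points_line //.
  by move=> P; rewrite in_fset_cond mem_pg2_points dH => /andP[/eqP -> ->].
apply: (sub_points_eq0 (S := [fset P in pg2_points | (P <= H)%VS])).
- by apply/fsubsetP => P; rewrite in_fset_cond => /andP[].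
- by rewrite card_points_line // ltnS; apply: ltnW card_field_gt1.
move=> P PH; apply: subv_trans (capvSr _ _) _.
exact: (subv_bigcap_fsetP _ _ (subvv _) _ PH).
Qed.

(** The two terms are \sum_P m_P, by double counting, and q^2 + q, the number of
    points minus one. *)
Lemma char_poly_thick :
  (char_poly_arr fullv A).[-1] =
  - 2 * (#|` A|%:Z * q.+1%:Z - (q ^ 2 + q)%:Z).
Proof.
rewrite char_poly_arr_rank3 ?dim_pg2 //; first last.
- exact: essential_thick.
- exact: central_lines.
rewrite big_fset_condE (_ : [fset _ | _ in _ & _] = pg2_points); last first.
  apply/fsetP => P; rewrite in_fset_cond mem_pg2_points andbC; apply: andb_idr.
  by move=> /eqP; exact: point_in_lattice.
have sumE : \sum_(P <- pg2_points) #|` [fset H in A | (P <= H)%VS]|%:Z =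
    #|` A|%:Z * q.+1%:Z.
  rewrite -PoszM -(sum_point_multiplicity sA) -[RHS]natz natr_sum.
  by apply: eq_bigr => P _; rewrite natz.
rewrite big_split /= sumE sumN1_fset card_points.
by rewrite !PoszD; ring.
Qed.

Lemma simplicial_thick : #|` A| = (3 * q)%N -> simplicial fullv A.
Proof.
move=> cardA; split; [exact: central_lines | exact: essential_thick |].
rewrite (eq_big_seq _ char_poly_restriction_thick) char_poly_thick dim_pg2.
under eq_bigr do rewrite -[2 * _]mul1r.
rewrite -big_distrl /=.
have -> : \sum_(H <- A) 1 = #|` A|%:Z by rewrite card_fset_sum1 -natz natr_sum.
rewrite cardA expnS expn1 -[q.+1]addn1 !(PoszD, PoszM); ring.
Qed.

End Thick.

End Plane.

(** * The deleted lines *)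

Section Removal.
Variables (F : finFieldType) (H : {vspace 'rV[F]_3}) (I J : finType).
Variables (v : I -> {vspace 'rV[F]_3}) (Hs : I -> J -> {vspace 'rV[F]_3}).
Implicit Types P X : {vspace 'rV[F]_3}.

Hypotheses (dH : \dim H = 2%N) (v_inj : injective v).
Hypothesis vP : forall i, \dim (v i) = 1%N /\ (v i <= H)%VS.
Hypothesis Hs_inj : forall i, injective (Hs i).
Hypothesis HsP : forall i j,
  [/\ \dim (Hs i j) = 2%N, Hs i j <> H & (v i <= Hs i j)%VS].

Lemma capv_removed i j : (H :&: Hs i j)%VS = v i.
Proof.
have [dHs /eqP nHsH svHs] := HsP i j; have [dv svH] := vP i.
apply/esym/point_eq => //; first by rewrite dim_capv_lines // eq_sym.
by rewrite subv_cap svH.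
Qed.

(** The index i is recovered from the trace v i of the line on H. *)
Lemma removed_inj : injective (fun ij : I * J => Hs ij.1 ij.2).
Proof.
move=> [i j] [i' j'] /= eqHs; have ii' : i = i'.
  by apply: v_inj; rewrite -(capv_removed i j) eqHs capv_removed.
by move: eqHs; rewrite -ii' => /Hs_inj ->.
Qed.

(** On H, the point P must be v i, so i is fixed and the pairs (i, j) are told
    apart by j; off H, two lines through v i and P coincide, so the pairs are told
    apart by i. *)
Lemma card_removed_through P : \dim P = 1%N ->
  (#|[set ij : I * J | (P <= Hs ij.1 ij.2)%VS]| <= maxn #|I| #|J|)%N.
Proof.
move=> dP; rewrite leq_max; apply/orP; have [sPH|nPH] := boolP (P <= H)%VS.
  right; rewrite -(card_in_imset (f := snd)) ?max_card //.
  move=> [i j] [i' j']; rewrite !inE /= => sP sP' ->; congr (_, _).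
  have sPv k l : (P <= Hs k l)%VS -> P = v k.
    move=> sPk; apply: point_eq; rewrite ?(vP k).1 //.
    by rewrite -(capv_removed k l) subv_cap sPH.
  by apply: v_inj; rewrite -(sPv _ _ sP) (sPv _ _ sP').
left; rewrite -(card_in_imset (f := fst)) ?max_card //.
move=> [i j] [i' j']; rewrite !inE /= => sP sP' ii'; rewrite -ii' in sP' *.
congr (_, _); apply: contraNeq nPH => njj'.
have [dHs _ svHs] := HsP i j; have [dHs' _ svHs'] := HsP i j'.
have nHs : Hs i j != Hs i j' by apply: contra_neq njj'; exact: Hs_inj.
have dcap := dim_capv_lines dHs dHs' nHs; have [dv svH] := vP i.
have -> : P = (Hs i j :&: Hs i j')%VS by apply: point_eq; rewrite // subv_cap sP.
by rewrite -(point_eq dv dcap) // subv_cap svHs.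
Qed.

End Removal.

Local Close Scope ring_scope.
Local Close Scope fset_scope.

Theorem proposition4p6 (F : finFieldType)
    (H : {vspace 'rV[F]_3})
    (v : 'I_(#|F| - 1) -> {vspace 'rV[F]_3})
    (Hs : 'I_(#|F| - 1) -> 'I_(#|F| - 1) -> {vspace 'rV[F]_3})
    (B : {fset {vspace 'rV[F]_3}}) :
  H \in pg2_lines F ->
  injective v ->
  (forall i, is_point (v i) /\ (v i <= H)%VS) ->
  (forall i, injective (Hs i)) ->
  (forall i j, [/\ Hs i j \in pg2_lines F, Hs i j <> H & (v i <= Hs i j)%VS]) ->
  B = (pg2_lines F `\` [fset Hs i j | i in 'I_(#|F| - 1), j in 'I_(#|F| - 1)])%fset ->
  simplicial fullv B /\ #|` B|%fset = (3 * #|F|)%N.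
Proof.
rewrite mem_pg2_lines => /eqP dH v_inj vP Hs_inj HsP defB.
have {}HsP i j : [/\ \dim (Hs i j) = 2, Hs i j <> H & (v i <= Hs i j)%VS].
  by have [] := HsP i j; rewrite mem_pg2_lines => /eqP.
pose R := [fset Hs ij.1 ij.2 | ij in {: 'I_(#|F| - 1) * 'I_(#|F| - 1)}]%fset.
have {}defB : B = (pg2_lines F `\` R)%fset.
  rewrite defB; congr (_ `\` _)%fset; apply/fsetP => X.
  apply/imfset2P/imfsetP => [[i _ [j _ ->]]|[[i j] _ ->]]; first by exists (i, j).
  by exists i => //; exists j.
have q1 := card_field_gt1 F; have inj_Hs := removed_inj dH v_inj vP Hs_inj HsP.
have sRL : (R `<=` pg2_lines F)%fset.
  apply/fsubsetP => X /imfsetP[[i j] _ ->] /=; have [dHs _ _] := HsP i j.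
  by rewrite mem_pg2_lines dHs.
have cardB : #|` B|%fset = 3 * #|F|.
  rewrite defB cardfsDS // card_pg2_lines card_imfset //= -cardE card_prod card_ord.
  have arith q : 1 < q -> q ^ 2 + q + 1 - (q - 1) * (q - 1) = 3 * q.
    by case: q => // q _; rewrite subn1 expnS expn1 /=; nia.
  exact: arith.
split=> //; apply: simplicial_thick => // [|P dP]; first by rewrite defB fsubsetDl.
pose Ls := [fset X in pg2_lines F | (P <= X)%VS]%fset.
pose Rs := [fset X in R | (P <= X)%VS]%fset.
have -> : [fset X in B | (P <= X)%VS]%fset = (Ls `\` Rs)%fset.
  rewrite defB /Ls /Rs; move: (pg2_lines F) => L; apply/fsetP => X.
  rewrite in_fsetD !in_fset_cond in_fsetD.
  by case: (P <= X)%VS; rewrite ?andbT ?andbF.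
have leRs : #|` Rs|%fset <= #|F| - 1.
  have := card_removed_through dH v_inj vP Hs_inj HsP dP; rewrite card_ord maxnn.
  set T := [set ij | _] => leT.
  have leRT : #|` [fset Hs ij.1 ij.2 | ij in T]|%fset <= #|T|.
    by rewrite cardE; exact: leq_imfset_card.
  apply: leq_trans (leq_trans leRT leT).
  apply/fsubset_leq_card/fsubsetP => X; rewrite in_fset_cond => /andP[].
  case/imfsetP => ij _ -> sP; apply/imfsetP; exists ij => //=.
  by rewrite inE.
have := cardfsID Rs Ls; rewrite (card_lines_through dP).
have := fsubset_leq_card (fsubsetIr Ls Rs); lia.
Qed.
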